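(* Let $G$ be a virtually nilpotent group, and let $N\leq G$ be a nilpotent subgroup of nilpotency class $n$ and finite index $m=[G:N]$. Then $G$ is strongly Howson and $$\xi_G(n_1,n_2) \leq \frac{(m(p-1)+1)^{n+1}-m(p-1)-1}{m(p-1)} + m - 1$$ for all integers $n_1,n_2\geq 2$, where $p=\min\{n_1,n_2\}$.
   Context: For a finitely generated group $H$, the rank is $\mathrm{rk}(H) = \min\{|X| : H = \langle X\rangle\}$ (infinite if $H$ is not finitely generated). A group $G$ is strongly Howson if for all $n_1,n_2 \in \mathbb{N}$, $$\sup\{\mathrm{rk}(H_1\cap H_2) \mid H_1,H_2\leq G,\ \mathrm{rk}(H_1)\leq n_1,\ \mathrm{rk}(H_2)\leq n_2\} < \infty.$$ In that case $\xi_G(n_1,n_2)$ denotes this supremum. For a group $N$, the lower central series is $N_0=N$, $N_i=[N,N_{i-1}]$ for $i\geq 1$; $N$ is nilpotent if $N_n=\{1\}$ for some $n\geq 1$, and the minimum such $n\ge 1$ is its nilpotency class. A group is virtually nilpotent if it has a nilpotent subgroup of finite index. Groups are not assumed to be finitely generated. *)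

(* Defs.v *)
From HB Require Import structures.
From mathcomp Require Import all_boot all_order all_algebra finmap.
From mathcomp Require Import mathcomp_extra boolp classical_sets functions.
From mathcomp Require Import cardinality reals ereal.
From mathcomp Require Export monoid.

Set Implicit Arguments.
Unset Strict Implicit.
Unset Printing Implicit Defensive.

Import Order.TTheory GRing.Theory Num.Theory.

Local Open Scope classical_set_scope.

Section Subgroups.
Variable G : groupType.
Implicit Types (A B H N : set G) (n m : nat).

Local Open Scope group_scope.

Definition subgroup H : Prop :=
  [/\ H 1, (forall x y, H x -> H y -> H (x * y))
    & forall x, H x -> H x^-1].

Definition gen A : set G := smallest subgroup A.

(* [A, B], the subgroup generated by the commutators *)
Definition commutator A B : set G :=
  gen [set g | exists x y, [/\ A x, B y & g = [~ x, y]]].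

Fixpoint lower_central N n : set G :=
  if n is i.+1 then commutator N (lower_central N i) else N.

Definition nilpotent N : Prop :=
  exists n, (1 <= n)%N /\ lower_central N n = [set 1].

(* The class is the least n >= 1 with N_n = 1; in particular the trivial group
   has class 1, not 0. *)
Definition nilpotency_class N n : Prop :=
  [/\ (1 <= n)%N, lower_central N n = [set 1] &
      forall k, (1 <= k)%N -> lower_central N k = [set 1] -> (n <= k)%N].

Definition lcosets H : set (set G) := [set [set g * h | h in H] | g in setT].

Definition has_index H m : Prop := (lcosets H #= `I_m)%card.

Definition finite_index H : Prop := finite_set (lcosets H).

End Subgroups.

Definition virtually_nilpotent (G : groupType) : Prop :=
  exists N : set G, [/\ subgroup N, nilpotent N & finite_index N].

Section Rank.
Variables (R : realType) (G : groupType).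

Local Open Scope ring_scope.
Local Open Scope ereal_scope.

(* Extended-real valued: the infimum of the empty set is +oo, so rk H = +oo
   when H is not finitely generated. *)
Definition rk (H : set G) : \bar R :=
  ereal_inf [set (#|` X|)%:R%:E | X in [set X : {fset G} | gen [set` X] = H]].

Definition xi (n1 n2 : nat) : \bar R :=
  ereal_sup [set r | exists H1 H2 : set G,
    [/\ subgroup H1 /\ subgroup H2, rk H1 <= n1%:R%:E, rk H2 <= n2%:R%:E
      & r = rk (H1 `&` H2)]].

Definition strongly_howson : Prop := forall n1 n2 : nat, xi n1 n2 < +oo.

End Rank.

Arguments xi R G n1 n2 : clear implicits.
Arguments strongly_howson R G : clear implicits.

(* Main.v *)
Require Import Defs.
From HB Require Import structures.
From mathcomp Require Import all_boot all_order all_algebra finmap.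
From mathcomp Require Import mathcomp_extra boolp classical_sets functions.
From mathcomp Require Import cardinality reals ereal zify.

(** The bound holds for every subgroup L of a p-generated subgroup H of G, hence
for any intersection of H with another subgroup. Put q = m (p - 1) + 1.

By the Schreier index formula [schreier_generated], K = H `&` N is generated by
q elements, and it is nilpotent of class at most n. The i-th layer of the lower
central series of K (i = 0, ..., n - 1) is an abelian group generated by the
classes of q ^ (i + 1) iterated commutators of the generators of K
[lower_central_generators]. A subgroup of an abelian group with r generators
needs at most r generators [subgroup_generators_mod], so L `&` N, which lies in
K, is filtered by subgroups of the layers and needs at most q + q ^ 2 + ... +
q ^ n generators [nilpotent_subgroup_generated]. Finally L is generated by
L `&` N and representatives of the at most m - 1 cosets other than L `&` N
itself [finite_index_generated]. Summing the geometric progression gives the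
bound; since the argument uses only one of the two subgroups, p can be the
smaller of the two ranks.

No quotient group is formed: generation of A modulo B is stated as
A `<=` gen (B `|` [set` s]), and generating sets are sequences, so that they
can be counted by their size. *)

Set Implicit Arguments.
Unset Strict Implicit.
Unset Printing Implicit Defensive.

Import Order.TTheory GRing.Theory Num.Theory.

(** * Generated subgroups *)

Section GroupTheory.
Variable G : groupType.
Implicit Types (A B C H K L N : set G) (s X Y T : seq G) (g t u x y : G).

Local Open Scope group_scope.
Local Open Scope classical_set_scope.

Lemma subgroup1 H : subgroup H -> H 1.
Proof. by case. Qed.

Lemma subgroupM H x y : subgroup H -> H x -> H y -> H (x * y).
Proof. by case=> _ + _; apply. Qed.

Lemma subgroupV H x : subgroup H -> H x -> H x^-1.
Proof. by case=> _ _; apply. Qed.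

Lemma subgroupX H x i : subgroup H -> H x -> H (x ^+ i).
Proof.
move=> sH Hx; elim: i => [|i IHi]; first exact: subgroup1.
by rewrite expgS; exact: subgroupM.
Qed.

Lemma subgroupI H K : subgroup H -> subgroup K -> subgroup (H `&` K).
Proof.
move=> sH sK; split; first by split; exact: subgroup1.
- by move=> x y [Hx Kx] [Hy Ky]; split; exact: subgroupM.
- by move=> x [Hx Kx]; split; exact: subgroupV.
Qed.

Lemma gen_subgroup A : subgroup (gen A).
Proof.
split.
- by move=> M [/subgroup1].
- move=> x y Ax Ay M MA; have [sM _] := MA.
  by apply: (subgroupM sM); [exact: Ax|exact: Ay].
- by move=> x Ax M MA; have [sM _] := MA; apply: (subgroupV sM); exact: Ax.
Qed.

Lemma sub_gen A : A `<=` gen A.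
Proof. exact: sub_gen_smallest. Qed.

Lemma gen_min A H : subgroup H -> A `<=` H -> gen A `<=` H.
Proof. exact: smallest_sub. Qed.

Lemma genS A B : A `<=` B -> gen A `<=` gen B.
Proof.
move=> AB; apply: gen_min; first exact: gen_subgroup.
exact: subset_trans AB (@sub_gen B).
Qed.

(** Every element of [gen A] is a word in the elements of [A] and their
inverses; [P] is followed while the word grows on the left. *)
Lemma gen_ind A (P : set G) : P 1 ->
    (forall x y, A x -> P y -> P (x * y) /\ P (x^-1 * y)) ->
  gen A `<=` P.
Proof.
move=> P1 PM.
pose Q := [set g | forall y, P y -> P (g * y) /\ P (g^-1 * y)].
have sQ : subgroup Q.
  split.
  - by move=> y Py; rewrite invg1 mul1g.
  - move=> g h Qg Qh y Py; rewrite invgM -!mulgA.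
    by split; [apply Qg; apply Qh|apply Qh; apply Qg].
  - by move=> g Qg y Py; rewrite invgK; case: (Qg y Py).
move=> g /(@gen_min A Q sQ) Qg.
have [] := Qg _ 1 P1; last by rewrite mulg1.
by move=> x Ax y; exact: PM.
Qed.

Definition generated_by (r : nat) H :=
  exists2 s, (size s <= r)%N & gen [set` s] = H.

(** * Subgroups of finitely generated abelian groups *)

Lemma subgroupJ B x y : subgroup B -> B x -> B [~ x, y] -> B (x ^ y).
Proof.
move=> sB Bx Bxy; have -> : x ^ y = x * [~ x, y] by rewrite commgEl mulVKg.
exact: subgroupM.
Qed.

(** The case B = 1 says that a subgroup of an abelian group with r generators
needs at most r generators. By induction on s = a :: s0, with C generated by B
and s0: the classes of the elements of L modulo C form a subgroup of the cyclic
group generated by a, hence one element l of L, whose exponent on a is minimal,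
generates L modulo L `&` C, to which the induction hypothesis applies. *)
Lemma subgroup_generators_mod A B L s :
    subgroup A -> subgroup B -> B `<=` A ->
    (forall x y, A x -> A y -> B [~ x, y]) -> [set` s] `<=` A ->
    subgroup L -> L `<=` gen (B `|` [set` s]) ->
  exists s', [/\ (size s' <= size s)%N, [set` s'] `<=` L &
    L `<=` gen ((L `&` B) `|` [set` s'])].
Proof.
move=> sA sB BA AB; elim: s L => [|a s IHs] L sAs sL Ls.
  exists [::]; split=> //.
  move=> g Lg; apply: sub_gen; left; split=> //.
  by apply: (gen_min sB _ (Ls _ Lg)) => x [].
have [C CE] : exists C, C = gen (B `|` [set` s]) by eexists.
have sC : subgroup C by rewrite CE; exact: gen_subgroup.
have As : [set` s] `<=` A by move=> x xs; apply: sAs; rewrite /= inE xs orbT.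
have Aa : A a by apply: sAs; rewrite /= mem_head.
have CA : C `<=` A by rewrite CE; apply: gen_min => // x [/BA|/As].
have BC : B `<=` C by rewrite CE => x Bx; apply: sub_gen; left.
have CJ x y : A y -> C x -> C (x ^ y).
  by move=> Ay Cx; apply: subgroupJ => //; apply: BC; apply: AB => //; exact: CA.
have Aai i : A (a ^+ i) by exact: subgroupX.
(* A product of a positive and a negative power of a avoids integer exponents:
   multiplying by a or a^-1 makes i or j grow. *)
have decomp g : gen (B `|` [set` a :: s]) g ->
    exists i j c, C c /\ g = a ^+ i * (a ^- j * c).
  apply: (@gen_ind _ [set g | exists i j c, C c /\ g = a ^+ i * (a ^- j * c)]).
    by exists 0%N, 0%N, 1; rewrite !expg0 invg1 !mul1g; split=> //; exact: subgroup1.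
  have step x y : C x -> (exists i j c, C c /\ y = a ^+ i * (a ^- j * c)) ->
      exists i j c, C c /\ x * y = a ^+ i * (a ^- j * c).
    move=> Cx [i [j [c [Cc ->]]]].
    exists i, j, (x ^ (a ^+ i * a ^- j) * c); split.
      apply: (subgroupM sC) => //; apply: CJ => //.
      by apply: (subgroupM sA) => //; exact: (subgroupV sA).
    by rewrite [RHS]mulgA [in RHS]mulgA -conjgC !mulgA.
  move=> x y /= [Bx|].
    by move=> Py; split; apply: step => //; [|apply: subgroupV => //]; exact: BC.
  rewrite inE => /predU1P[->|xs]; last first.
    have Cx : C x by rewrite CE; apply: sub_gen; right.
    by move=> Py; split; apply: step => //; exact: subgroupV.
  move=> [i [j [c [Cc ->]]]]; split.
    by exists i.+1, j, c; rewrite expgS !mulgA.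
  exists i, j.+1, c; split=> //.
  have cij : commute a^-1 (a ^+ i).
    by apply: commuteX; apply: commute_sym; apply: commuteV.
  by rewrite expgSr invgM !mulgA cij.
have LsC : L `&` C `<=` gen (B `|` [set` s]) by rewrite -CE; exact: subIsetr.
have [s' [size_s' s'L Ls']] := IHs (L `&` C) As (subgroupI sL sC) LsC.
have LCs' s'' : {subset s' <= s''} ->
    L `&` C `<=` gen ((L `&` B) `|` [set` s'']).
  move=> s's''; apply: subset_trans Ls' _; apply: genS.
  move=> x [[[Lx _] Bx]|/s's'']; first by left.
  by right.
(* Up to inversion, an element of L has a natural exponent on a. *)
have suffP s'' : (forall d c, C c -> L (a ^+ d * c) ->
      gen ((L `&` B) `|` [set` s'']) (a ^+ d * c)) ->
    L `<=` gen ((L `&` B) `|` [set` s'']).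
  move=> Ps'' g Lg; have [i [j [c [Cc gE]]]] := decomp _ (Ls _ Lg).
  have [ji|/ltnW ij] := leqP j i.
    have gE' : g = a ^+ (i - j) * c by rewrite gE expgnFr // !mulgA.
    by rewrite gE'; apply: Ps'' => //; rewrite -gE'.
  have gE' : g^-1 = a ^+ (j - i) * (c^-1 ^ (a ^+ (j - i))).
    rewrite -conjgC gE !invgM !invgK expgnFr // !mulgA; congr (_ * _).
  rewrite -[g]invgK; apply: (subgroupV (gen_subgroup _)).
  rewrite gE'; apply: Ps''; first by apply: CJ => //; exact: subgroupV.
  by rewrite -gE'; exact: subgroupV.
have [kP|noP] := pselect (exists k,
    (0 < k)%N && `[< exists2 c, C c & L (a ^+ k * c) >]); last first.
  exists s'; split; [exact: leqW|by move=> x /s'L[]|].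
  apply: suffP => d c Cc Ld; case: d Ld => [|d] Ld.
    by apply: LCs' => //; split=> //; rewrite expg0 mul1g.
  by case: noP; exists d.+1; apply/asboolP; exists c.
case: (ex_minnP kP) => k /andP[k_gt0 /asboolP[b Cb Lb]] kmin.
pose l := a ^+ k * b.
exists (l :: s'); split => //.
  by move=> x; rewrite /= inE => /predU1P[->//|/s'L[]].
apply: suffP => d; elim/ltn_ind: d => d IHd c Cc Ld.
have sgen := gen_subgroup ((L `&` B) `|` [set` l :: s']).
have [d0|d_gt0] := posnP d.
  apply: LCs'; first by move=> x xs'; rewrite inE xs' orbT.
  by split=> //; rewrite d0 expg0 mul1g.
have kd : (k <= d)%N.
  by apply: kmin; rewrite d_gt0; apply/asboolP; exists c.
have lE : l^-1 * (a ^+ d * c) = a ^+ (d - k) * (b^-1 ^ (a ^+ (d - k)) * c).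
  by rewrite [RHS]mulgA -conjgC -{1}(subnKC kd) expgnDr /l invgM -!mulgA mulKg.
(* Dividing by l lowers the exponent d by k, as in Euclidean division. *)
rewrite -[a ^+ d * c](mulVKg l) lE; apply: (subgroupM sgen).
  by apply: sub_gen; right; rewrite /= mem_head.
apply: IHd; first by rewrite ltn_subrL k_gt0.
  by apply: subgroupM => //; apply: CJ => //; exact: subgroupV.
by rewrite -lE; apply: subgroupM => //; exact: subgroupV.
Qed.

(** * Lower central series *)

Section LowerCentral.
Variable K : set G.
Hypothesis sK : subgroup K.
Notation gamma := (lower_central K).

Lemma lower_central_subgroup i : subgroup (gamma i).
Proof. by case: i => [//|i]; exact: gen_subgroup. Qed.

Lemma lower_central_comm i x y : K x -> gamma i y -> gamma i.+1 [~ x, y].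
Proof. by move=> Kx gy; apply: sub_gen; exists x, y. Qed.

Lemma lower_centralS i : gamma i.+1 `<=` gamma i.
Proof.
elim: i => [|i IHi].
  apply: gen_min => // _ [x [y [Kx Ky ->]]].
  by rewrite commgEl conjgE; do !apply: subgroupM => //; exact: subgroupV.
apply: gen_min; first exact: lower_central_subgroup.
by move=> _ [x [y [Kx /IHi gy ->]]]; exact: lower_central_comm.
Qed.

Lemma lower_central_sub i : gamma i `<=` K.
Proof. by elim: i => // i; apply: subset_trans; exact: lower_centralS. Qed.

(** Modulo gamma i.+2, the commutator [~ x, y] of x in K and y in gamma i is
multiplicative in each variable, so the commutators of generators generate
gamma i.+1. Concretely, M, generated by gamma i.+2 and these commutators, is
normalised by K; then the identities for [~ g * h, y] and [~ g, x * z] show that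
the set of g, and next the set of y, whose commutators lie in M are
subgroups. *)
Lemma lower_central_step X Y i :
    [set` X] `<=` K -> K `<=` gen [set` X] -> [set` Y] `<=` gamma i ->
    gamma i `<=` gen (gamma i.+1 `|` [set` Y]) ->
  let Z := [seq [~ x, y] | x <- X, y <- Y] in
  [set` Z] `<=` gamma i.+1 /\ gamma i.+1 `<=` gen (gamma i.+2 `|` [set` Z]).
Proof.
move=> XK KX Yg gY Z.
have Zg : [set` Z] `<=` gamma i.+1.
  move=> z /allpairsP[[x y] /= [xX yY ->]].
  by apply: lower_central_comm; [exact: XK|exact: Yg].
split=> //.
have [M ME] : exists M, M = gen (gamma i.+2 `|` [set` Z]) by eexists.
have sM : subgroup M by rewrite ME; exact: gen_subgroup.
have gM : gamma i.+2 `<=` M by rewrite ME => x gx; apply: sub_gen; left.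
have Mg : M `<=` gamma i.+1.
  by rewrite ME; apply: gen_min; [exact: gen_subgroup|move=> x [/lower_centralS|/Zg]].
have MJ x y : K x -> M y -> M (y ^ x).
  move=> Kx My; apply: subgroupJ => //; rewrite -invgR.
  apply: subgroupV => //; apply: gM; apply: lower_central_comm => //.
  exact: Mg.
have commY y : y \in Y -> forall g, K g -> M [~ g, y].
  move=> yY; pose S := [set g | K g /\ M [~ g, y]].
  have sS : subgroup S.
    split.
    - by split; [exact: subgroup1|rewrite comm1g; exact: subgroup1].
    - move=> g h [Kg Mg'] [Kh Mh]; split; first exact: subgroupM.
      have -> : [~ g * h, y] = [~ g, y] ^ h * [~ h, y].
        by rewrite !commgEl !conjgE !invgM !mulgA !mulgK.
      by apply: subgroupM => //; exact: MJ.
    - move=> g [Kg Mg']; split; first exact: subgroupV.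
      have -> : [~ g^-1, y] = ([~ g, y]^-1) ^ (g^-1).
        by rewrite invgR !commgEl !conjgE !invgK !mulgA mulgK.
      by apply: MJ; exact: subgroupV.
  move=> g Kg; apply: (@gen_min [set` X] S sS _ _ (KX _ Kg)).2.
  move=> x xX; split; first exact: XK.
  by rewrite ME; apply: sub_gen; right; apply/allpairsP; exists (x, y).
rewrite -ME; apply: gen_min => // _ [g [y [Kg gy ->]]]; move: g Kg.
pose S := [set y | gamma i y /\ forall g, K g -> M [~ g, y]].
have sS : subgroup S.
  split.
  - split; first exact: (subgroup1 (lower_central_subgroup i)).
    by move=> g _; rewrite commg1; exact: subgroup1.
  - move=> x z [gx Mx] [gz Mz]; split.
      by apply: subgroupM => //; exact: lower_central_subgroup.
    move=> g Kg.
    have -> : [~ g, x * z] = [~ g, z] * [~ g, x] ^ z.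
      by rewrite !commgEl !conjgE !invgM !mulgA !mulgK.
    apply: subgroupM => //; first exact: Mz.
    by apply: MJ; [exact: lower_central_sub gz|exact: Mx].
  - move=> x [gx Mx]; split.
      by apply: subgroupV => //; exact: lower_central_subgroup.
    move=> g Kg.
    have -> : [~ g, x^-1] = ([~ g, x]^-1) ^ (x^-1).
      by rewrite invgR !commgEl !conjgE !invgK !mulgA mulgV mul1g.
    apply: MJ; first by apply: subgroupV => //; exact: lower_central_sub gx.
    by apply: subgroupV => //; exact: Mx.
apply: (@gen_min _ S sS _ _ (gY _ gy)).2.
move=> x [gx|xY].
  split; first exact: lower_centralS.
  by move=> g Kg; apply: gM; exact: lower_central_comm.
by split; [exact: Yg|exact: commY].
Qed.

Lemma lower_central_generators q i : generated_by q K ->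
  exists Y, [/\ (size Y <= q ^ i.+1)%N, [set` Y] `<=` gamma i &
    gamma i `<=` gen (gamma i.+1 `|` [set` Y])].
Proof.
move=> [X sizeX KX]; have XK : [set` X] `<=` K by rewrite -KX; exact: sub_gen.
elim: i => [|i [Y [sizeY Yg gY]]].
  exists X; split; rewrite ?expn1 //= -[X in X `<=` _]KX.
  by apply: genS => x xX; right.
have [|Zg gZ] := lower_central_step XK _ Yg gY; first by rewrite KX.
by eexists; split; [|exact: Zg|exact: gZ]; rewrite size_allpairs expnS leq_mul.
Qed.

(** Going up the series from gamma n = 1, each L `&` gamma i needs, besides
generators of L `&` gamma i.+1, no more elements than the layer
gamma i / gamma i.+1 has generators. *)
Lemma nilpotent_subgroup_generated q n L :
    generated_by q K -> gamma n = [set 1] -> subgroup L -> L `<=` K ->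
  generated_by (\sum_(i < n) q ^ i.+1) L.
Proof.
move=> Kq gn sL LK; rewrite -(big_mkord xpredT (fun i => q ^ i.+1)%N).
suff layers i : gamma (i + n) = [set 1] ->
    generated_by (\sum_(i <= j < i + n) q ^ j.+1)%N (L `&` gamma i).
  by have := layers 0%N gn; rewrite (setIidl LK).
elim: n i {gn} => [|n IHn] i.
  rewrite addn0 => gi1; exists [::] => //; apply/seteqP; split.
    by apply: gen_min => //; exact: subgroupI (lower_central_subgroup i).
  by rewrite gi1 => _ [_ ->]; exact: subgroup1 (gen_subgroup _).
rewrite addnS -addSn => gn.
have [s size_s sE] := IHn _ gn.
have [Y [sizeY Yg gY]] := lower_central_generators i Kq.
have [||s' [size_s' s'L Ls']] := @subgroup_generators_mod (gamma i) (gamma i.+1)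
    (L `&` gamma i) Y (lower_central_subgroup i) (lower_central_subgroup i.+1)
    (@lower_centralS i) _ Yg (subgroupI sL (lower_central_subgroup i)).
- by move=> x y gx gy; apply: lower_central_comm => //; exact: lower_central_sub gx.
- by move=> x [_ /gY].
exists (s' ++ s).
  rewrite size_cat big_ltn ?ltnS ?leq_addr // leq_add //.
  exact: leq_trans sizeY.
have sLg := subgroupI sL (lower_central_subgroup i).
apply/seteqP; split.
  apply: gen_min => // x; rewrite /= mem_cat => /orP[/s'L//|xs].
  have [Lx /lower_centralS gx] : (L `&` gamma i.+1) x by rewrite -sE; exact: sub_gen.
  by split.
apply: subset_trans Ls' _; apply: gen_min; first exact: gen_subgroup.
move=> x [[[Lx _] gx]|xs']; last by apply: sub_gen; rewrite /= mem_cat xs'.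
have : gen [set` s] x by rewrite sE.
by apply: genS => y ys; rewrite /= mem_cat ys orbT.
Qed.

End LowerCentral.

(** * Finite index subgroups *)

(** The elements of T lie in distinct right cosets K t. Right cosets suit the
Schreier graph, on which generators act by right multiplication. *)
Definition coset_indep K T :=
  uniq T /\ {in T &, forall t u, K (t * u^-1) -> t = u}.

Lemma coset_indep_cons K T u : subgroup K -> coset_indep K T ->
  (forall t, t \in T -> ~ K (u * t^-1)) -> coset_indep K (u :: T).
Proof.
move=> sK [uT iT] uNT; split.
  rewrite /= uT andbT; apply/negP => /uNT; apply.
  by rewrite mulgV; exact: subgroup1.
move=> x y; rewrite !inE => /predU1P[->|xT] /predU1P[->|yT] //.
- by move/(uNT _ yT).
- by move/(subgroupV sK); rewrite invgM invgK => /(uNT _ xT).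
- exact: iT.
Qed.

(** The index counts left cosets; inversion exchanges them with the right ones,
whence the map from t to the coset of t^-1. *)
Lemma coset_indep_index K m T :
  subgroup K -> has_index K m -> coset_indep K T -> (size T <= m)%N.
Proof.
move=> sK /card_set_bijP[f [fm finj _]] [uT iT].
have cosetP t : lcosets K [set t^-1 * k | k in K] by exists t^-1.
pose F t := f [set t^-1 * k | k in K].
have Finj : {in T &, injective F}.
  move=> t u tT uT'; rewrite /F => /finj.
  rewrite !inE => /(_ (cosetP _) (cosetP _)) E.
  have [k Kk] : [set t^-1 * k | k in K] u^-1.
    by rewrite E; exists 1; [exact: subgroup1|rewrite mulg1].
  by move=> /(canRL (mulVKg _)) kE; apply: iT => //; rewrite -kE.
rewrite -(size_map F) -[X in (_ <= X)%N](size_iota 0).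
apply: uniq_leq_size; first by rewrite map_inj_in_uniq.
by move=> _ /mapP[t _ ->]; rewrite mem_iota; exact: fm.
Qed.

Lemma maximal_seq (P : seq G -> Prop) m T0 :
    P T0 -> (forall T, P T -> (size T <= m)%N) ->
  exists2 T, P T & forall u, ~ P (u :: T).
Proof.
move=> PT0 Pm.
have exP : exists k, `[< exists2 T, P T & size T = k >].
  by exists (size T0); apply/asboolP; exists T0.
have leP k : `[< exists2 T, P T & size T = k >] -> (k <= m)%N.
  by move=> /asboolP[T PT <-]; exact: Pm.
case: (ex_maxnP exP leP) => k /asboolP[T PT Tk] kmax.
exists T => // u PuT; have := kmax (size (u :: T)); rewrite -Tk /= ltnn.
by apply/implyP/asboolP; exists (u :: T).
Qed.

(** A maximal independent sequence T in L meets every coset of K that meets L.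
Its element 1 is dropped, which saves one generator. *)
Lemma finite_index_generated K m r L : subgroup K -> has_index K m ->
  subgroup L -> generated_by r (L `&` K) -> generated_by (r + m.-1) L.
Proof.
move=> sK Km sL [s size_s sE].
pose P T := [/\ 1 \in T, [set` T] `<=` L & coset_indep K T].
have P1 : P [:: 1].
  split; first by rewrite mem_head.
    by move=> x; rewrite /= inE => /eqP->; exact: subgroup1.
  by split=> // x y; rewrite !inE => /eqP-> /eqP->.
have [|T [T1 TL iT] Tmax] := maximal_seq P1 (m := m).
  by move=> T [_ _]; exact: coset_indep_index.
exists (s ++ rem 1 T).
  rewrite size_cat leq_add // size_rem // -!subn1 leq_sub2r //.
  exact: coset_indep_index iT.
have sLK x : x \in s -> (L `&` K) x by move=> xs; rewrite -sE; exact: sub_gen.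
apply/seteqP; split.
  apply: gen_min => // x; rewrite /= mem_cat => /orP[/sLK[]//|/mem_rem/TL//].
move=> g Lg; have sgen := gen_subgroup [set` s ++ rem 1 T].
have [t tT Kgt] : exists2 t, t \in T & K (g * t^-1).
  apply: contrapT => noT; apply: (Tmax g); split.
  - by rewrite inE T1 orbT.
  - by move=> x; rewrite /= inE => /predU1P[->//|]; exact: TL.
  - by apply: coset_indep_cons => // t tT Kgt; apply: noT; exists t.
rewrite -(mulgVK t g); apply: (subgroupM sgen).
  have : gen [set` s] (g * t^-1).
    rewrite sE; split=> //; apply: subgroupM => //.
    by apply: subgroupV => //; exact: TL.
  by apply: genS => x xs; rewrite /= mem_cat xs.
have [->|tN1] := eqVneq t 1; first exact: subgroup1.
by apply: sub_gen; rewrite /= mem_cat (rem_filter _ iT.1) mem_filter /= tN1 tT orbT.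
Qed.

Lemma count_ltn_sub (I : eqType) (P Q : pred I) (r : seq I) a :
  subpred Q P -> a \in r -> P a -> ~~ Q a -> (count Q r < count P r)%N.
Proof.
move=> QP /splitPr[r1 r2] Pa /negPf Qa; rewrite !count_cat /= Pa Qa.
by rewrite -addnS leq_add ?sub_count // add0n add1n ltnS sub_count.
Qed.

(** Number of edges from t to t * x with both ends in T, in the Cayley graph of
the generators X. The Schreier generator of such an edge is trivial, because
t * x represents its own coset. *)
Definition schreier_edges X T :=
  count (fun e : G * G => e.1 * e.2 \in T) [seq (t, x) | t <- T, x <- X].

Lemma schreier_edges_cons X T t x u : t \in T -> x \in X -> u \notin T ->
  u = t * x \/ u = t * x^-1 -> (schreier_edges X T < schreier_edges X (u :: T))%N.
Proof.
move=> tT xX uT uE; rewrite /schreier_edges allpairs_cons count_cat.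
set P := fun e : G * G => _ \in _ :: _; set Q := fun e : G * G => _ \in T.
have QP : subpred Q P by move=> e; rewrite /Q /P inE orbC => ->.
case: uE => uE; last first.
  rewrite -add1n leq_add ?sub_count // -has_count.
  apply/hasP; exists (u, x); first exact: map_f.
  by rewrite /P /= uE mulgVK inE tT orbT.
apply: ltn_addl; apply: (@count_ltn_sub _ _ _ _ (t, x)) => //.
- exact: allpairs_f.
- by rewrite /P /= uE mem_head.
- by rewrite /Q /= -uE.
Qed.

(** Schreier's theorem, with the number of generators. Grow T from 1 by
multiplying elements of T by generators or their inverses, keeping the cosets
distinct: each new element brings a new edge, so T carries at least size T - 1
of them, as a tree would. When T is maximal it represents every coset reached
from 1, and H `&` K is generated by the elements t * x * (rep (t * x))^-1.
Those of the edges counted above are trivial, which leaves at most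
size T * p - (size T - 1) generators. *)
Lemma schreier_generated K H m p : subgroup K -> has_index K m ->
  (0 < p)%N -> generated_by p H -> generated_by (m * p.-1).+1 (H `&` K).
Proof.
move=> sK Km p_gt0 [X size_X XE].
have sH : subgroup H by rewrite -XE; exact: gen_subgroup.
have XH : [set` X] `<=` H by rewrite -XE; exact: sub_gen.
pose P T := [/\ 1 \in T, [set` T] `<=` H, coset_indep K T &
  (size T <= (schreier_edges X T).+1)%N].
have P1 : P [:: 1].
  split; rewrite ?mem_head //.
    by move=> x; rewrite /= inE => /eqP->; exact: subgroup1.
  by split=> // x y; rewrite !inE => /eqP-> /eqP->.
have [|T [T1 TH iT sizeT] Tmax] := maximal_seq P1 (m := m).
  by move=> T [_ _ iT _]; exact: coset_indep_index iT.
have repP t x u : t \in T -> x \in X -> u = t * x \/ u = t * x^-1 ->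
    exists2 t', t' \in T & K (u * t'^-1).
  move=> tT xX uE; apply: contrapT => noT; apply: (Tmax u).
  have iuT : coset_indep K (u :: T).
    by apply: coset_indep_cons => // t' t'T Kut; apply: noT; exists t'.
  split=> //; first by rewrite inE T1 orbT.
    move=> y; rewrite /= inE => /predU1P[->|/TH//].
    have [Ht Hx] := (TH _ tT, XH _ xX).
    by case: uE => ->; apply: subgroupM => //; exact: subgroupV.
  rewrite /= ltnS (leq_trans sizeT) // (schreier_edges_cons tT xX) //.
  by have /andP[] := iuT.1.
pose rep u := nth 1 T (find (fun t => `[< K (u * t^-1) >]) T).
have rep_spec u : (exists2 t, t \in T & K (u * t^-1)) ->
    rep u \in T /\ K (u * (rep u)^-1).
  move=> [t tT Kut].
  have hasT : has (fun t => `[< K (u * t^-1) >]) T.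
    by apply/hasP; exists t => //; apply/asboolP.
  split; first by rewrite mem_nth // -has_find.
  by apply/asboolP; exact: (nth_find 1 hasT).
have repE u t : t \in T -> K (u * t^-1) -> rep u = t.
  move=> tT Kut; have [] := rep_spec u; first by exists t.
  move=> rT Kur; apply: iT.2 => //.
  rewrite -(mulKg u t^-1) mulgA -[rep u]invgK -invgM.
  by apply: (subgroupM sK) => //; exact: (subgroupV sK).
pose nontree := [pred e : G * G | e.1 * e.2 \notin T].
pose S := [seq e.1 * e.2 * (rep (e.1 * e.2))^-1
            | e <- [seq (t, x) | t <- T, x <- X] & nontree e].
have SHK : [set` S] `<=` H `&` K.
  move=> y /mapP[e]; rewrite mem_filter => /andP[_ /allpairsP[[t x] [tT xX ->]]] ->.
  rewrite /= in tT xX *.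
  have [|rT Kr] := rep_spec (t * x); first by apply: (repP t x) => //; left.
  split=> //=; apply: (subgroupM sH); last by apply: (subgroupV sH); exact: TH.
  by apply: (subgroupM sH); [exact: TH|exact: XH].
have sS := gen_subgroup [set` S].
have Sgen t x : t \in T -> x \in X -> gen [set` S] (t * x * (rep (t * x))^-1).
  move=> tT xX; have [txT|txNT] := boolP (t * x \in T).
    rewrite (repE _ (t * x)) // mulgV; exact: subgroup1.
  apply: sub_gen; apply/mapP; exists (t, x) => //.
  by rewrite mem_filter /nontree /= txNT allpairs_f.
exists S.
  rewrite size_map size_filter.
  have := count_predC (fun e : G * G => e.1 * e.2 \in T) [seq (t, x) | t <- T, x <- X].
  rewrite size_allpairs -/(schreier_edges X T) -/(count nontree _).
  have : (size T * size X <= size T * p)%N by rewrite leq_mul.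
  have : (size T * p.-1 <= m * p.-1)%N.
    by rewrite leq_mul // (coset_indep_index sK Km iT).
  have -> : (size T * p = size T + size T * p.-1)%N by rewrite -mulnS prednK.
  rewrite (_ : count (predC _) _ = count nontree [seq (t, x) | t <- T, x <- X]) //.
  move: sizeT; move: (size T * p.-1)%N (m * p.-1)%N (size T * size X)%N => a b c.
  by move: (schreier_edges X T) (count _ _) => d e; lia.
apply/seteqP; split; first by apply: gen_min => //; exact: subgroupI.
(* U is the union of the cosets <S> t with t in T; it is closed under right
   multiplication by the generators of H and their inverses, so it contains H. *)
pose U g := exists2 t, t \in T & gen [set` S] (g * t^-1).
have UX g x : x \in X -> U g -> U (g * x) /\ U (g * x^-1).
  move=> xX [t tT Sgt]; split.
    have [|rT _] := rep_spec (t * x); first by apply: (repP t x) => //; left.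
    exists (rep (t * x)) => //.
    have -> : g * x * (rep (t * x))^-1 = g * t^-1 * (t * x * (rep (t * x))^-1).
      by rewrite !mulgA mulgVK.
    by apply: (subgroupM sS) => //; exact: Sgen.
  have [|t' t'T Kt'] := repP t x (t * x^-1) tT xX; first by right.
  exists t' => //.
  (* The edge labelled x from t' ends in the coset of t. *)
  have tE : rep (t' * x) = t.
    apply: repE => //; move/(subgroupV sK): Kt'.
    by rewrite !invgM !invgK mulgA.
  have := Sgen _ _ t'T xX; rewrite tE => /(subgroupV sS).
  rewrite !invgM invgK => St'.
  have -> : g * x^-1 * t'^-1 = g * t^-1 * (t * (x^-1 * t'^-1)).
    by rewrite !mulgA mulgVK.
  exact: (subgroupM sS).
have HU g : H g -> U g.
  have : gen [set` X] `<=` [set g | U g^-1].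
    apply: gen_ind; first by exists 1; rewrite //= invg1 mulg1; exact: subgroup1.
    move=> x y xX /= /(UX _ _ xX)[Uyx UyxV].
    by rewrite !invgM invgK.
  by rewrite XE => HUV Hg; rewrite -[g]invgK; apply: HUV; exact: subgroupV.
move=> g [/HU[t tT Sgt] Kg].
have Kgt : K (g * t^-1).
  suff SK : gen [set` S] `<=` K by exact: SK.
  by apply: gen_min => // x /SHK[].
suff <- : g * t^-1 = g by [].
suff -> : t = 1 by rewrite invg1 mulg1.
apply: iT.2 => //; rewrite invg1 mulg1 -(mulgVK g t) -[t * _]invgK invgM invgK.
by apply: (subgroupM sK) => //; exact: (subgroupV sK).
Qed.

(** * Virtually nilpotent groups *)

Lemma lower_central_mono A B i : A `<=` B -> lower_central A i `<=` lower_central B i.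
Proof.
move=> AB; elim: i => // i IHi; apply: genS => _ [x [y [Ax Ay ->]]].
by exists x, y; split=> //; [exact: AB|exact: IHi].
Qed.

Lemma virtually_nilpotent_subgroup_generated N H L n m p :
    subgroup N -> lower_central N n = [set 1] -> has_index N m ->
    (0 < p)%N -> generated_by p H -> subgroup H -> subgroup L -> L `<=` H ->
  generated_by (\sum_(i < n) (m * p.-1).+1 ^ i.+1 + m.-1) L.
Proof.
move=> sN Nn Nm p0 Hp sH sL LH.
apply: (@finite_index_generated N) => //.
apply: (@nilpotent_subgroup_generated (H `&` N)) => //.
- exact: subgroupI.
- exact: schreier_generated.
- apply/seteqP; split.
    by rewrite -Nn; apply: lower_central_mono => x [].
  move=> _ ->; apply: subgroup1; apply: lower_central_subgroup; exact: subgroupI.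
- exact: subgroupI.
- exact: setSI.
Qed.

Lemma generated_by_le r r' H : (r <= r')%N -> generated_by r H -> generated_by r' H.
Proof. by move=> rr' [s sr sE]; exists s => //; exact: leq_trans rr'. Qed.

End GroupTheory.

Local Open Scope ring_scope.

Lemma sum_powers_shift (F : fieldType) (q : F) n : q != 1 ->
  \sum_(i < n) q ^+ i.+1 = (q ^+ n.+1 - q) / (q - 1).
Proof.
rewrite -subr_eq0 => q1; apply: (canRL (mulfK q1)); rewrite mulrC.
under eq_bigr do rewrite exprS.
by rewrite -mulr_sumr mulrCA -subrX1 mulrBr mulr1 -exprS.
Qed.

Section Rank.
Variables (R : realType) (G : groupType).
Implicit Types (H N : set G).

(** The numbers of generators are natural, so the infimum is attained as soon
as it is finite. *)
Lemma rk_le H (k : nat) : (rk R H <= k%:R%:E)%E <-> generated_by k H.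
Proof.
split=> [rkH|[s sk sE]].
  apply: contrapT => Hk.
  suff : (k.+1%:R%:E <= rk R H)%E.
    by move=> /le_trans/(_ rkH); rewrite lee_fin ler_nat ltnn.
  apply: le_ereal_inf_tmp => y [X XH <-].
  rewrite lee_fin ler_nat ltnNge; apply/negP => Xk; apply: Hk.
  by exists (enum_fset X) => //; rewrite -XH.
apply: ge_ereal_inf; exists (#|` [fset x in s]%fset|)%:R%:E.
  exists [fset x in s]%fset => //=; rewrite -sE; congr gen.
  by apply/seteqP; split=> x /=; rewrite inE.
by rewrite lee_fin ler_nat (leq_trans _ sk) // card_fseq size_undup.
Qed.

Lemma xi_le N (n m p n1 n2 : nat) :
    subgroup N -> lower_central N n = [set 1%g]%classic -> has_index N m ->
    (0 < p)%N -> (n1 <= p)%N || (n2 <= p)%N ->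
  (xi R G n1 n2 <= (\sum_(i < n) (m * p.-1).+1 ^ i.+1 + m.-1)%N%:R%:E)%E.
Proof.
move=> sN Nn Nm p0 np; apply: ge_ereal_sup => y [H1 [H2 [[sH1 sH2]]]].
move=> /rk_le H1n /rk_le H2n ->; apply/rk_le.
have sI := subgroupI sH1 sH2.
case/orP: np => [/generated_by_le/(_ H1n) Hp|/generated_by_le/(_ H2n) Hp];
  by apply: (virtually_nilpotent_subgroup_generated sN Nn Nm p0 Hp) => // x [].
Qed.

End Rank.

Theorem theorem3p7 (R : realType) (G : groupType) (hG : virtually_nilpotent G)
    (N : set G) (n m : nat) (hN : subgroup N) (hNn : nilpotency_class N n)
    (hNm : has_index N m) :
  strongly_howson R G /\
  forall n1 n2 : nat, (2 <= n1)%N -> (2 <= n2)%N ->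
    let p : R := (minn n1 n2)%:R in
    (xi R G n1 n2 <=
      (((m%:R * (p - 1) + 1) ^+ n.+1 - m%:R * (p - 1) - 1) / (m%:R * (p - 1))
        + m%:R - 1)%:E)%E.
Proof.
have [_ Nn _] := hNn; split=> [n1 n2|n1 n2 n1_ge2 n2_ge2].
  apply: (@le_lt_trans _ _ _ _ _ (@xi_le R G N n m n1.+1 n1 n2 hN Nn hNm _ _)) => //.
    by rewrite leqnSn.
  exact: ltry.
cbv zeta; set p : R := (minn n1 n2)%:R.
have min_ge2 : (2 <= minn n1 n2)%N by rewrite leq_min n1_ge2.
have m_gt0 : (0 < m)%N.
  apply: (coset_indep_index (T := [:: 1%g]) hN hNm).
  by split=> // x y; rewrite !inE => /eqP-> /eqP->.
apply: le_trans (@xi_le R G N n m (minn n1 n2) n1 n2 hN Nn hNm _ _) _.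
- exact: ltnW.
- by rewrite !leq_min !leqnn andbT leq_total.
have pE : (minn n1 n2).-1%:R = p - 1 :> R by rewrite -subn1 natrB // ltnW.
have q_neq1 : m%:R * (p - 1) + 1 != 1 :> R.
  rewrite -subr_eq0 addrK -pE mulf_neq0 // pnatr_eq0 -lt0n //.
  by rewrite -subn1 subn_gt0.
rewrite lee_fin natrD natr_sum -[m.-1]subn1 natrB // addrA.
under eq_bigr do rewrite natrX -natr1 natrM pE.
by rewrite sum_powers_shift // opprD !addrA addrK.
Qed.
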